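(* Let $\Delta$ be a contractible simplicial complex on $[n]$. Assume that $S/I_{\Delta}^{(2)}$ is generalized Cohen-Macaulay. Then $$H^i_{\mathfrak m}(S/I_{\Delta}^{(2)})= [H^i_{\mathfrak m}(S/I_{\Delta}^{(2)})]_{\mathbf 0} \oplus \bigoplus_{u=1}^n [H^i_{\mathfrak m}(S/I_{\Delta}^{(2)})]_{\mathbf e_u} \oplus \bigoplus_{\{u,v\}\notin \Delta}[H^i_{\mathfrak m}(S/I_{\Delta}^{(2)})]_{\mathbf e_u+\mathbf e_v}$$ for all $i\in\mathbb N$ with $i<\dim(S/I_{\Delta}^{(2)})$, where the last sum runs over the two-element subsets $\{u,v\}\subseteq[n]$ that are not faces of $\Delta$.
   Context: $k$ is a fixed field, $[n]=\{1,\dots,n\}$, $S=k[x_1,\dots,x_n]$, $\mathfrak m=(x_1,\dots,x_n)S$; $\mathbb N$ is the set of nonnegative integers. A simplicial complex $\Delta$ on $[n]$ is a collection of subsets of $[n]$ closed under taking subsets; $I_\Delta=(\prod_{i\in F}x_i : F\subseteq[n],F\notin\Delta)$ is its Stanley-Reisner ideal, and $I_\Delta^{(2)}=\bigcap_F P_F^2$, where $F$ runs over the facets of $\Delta$ and $P_F=(x_j : j\notin F)S$. An edge $\{u,v\}\in\Delta$ (with $u\neq v$) is contractible if every face $F\in\Delta$ satisfying $F\cup\{u\}\in\Delta$ and $F\cup\{v\}\in\Delta$ also satisfies $F\cup\{u,v\}\in\Delta$; $\Delta$ is contractible if each of its edges is contractible (this is not topological contractibility). $S/I$ is generalized Cohen-Macaulay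 if $H^i_{\mathfrak m}(S/I)$ has finite length for all $i<\dim(S/I)$. For a monomial ideal $I$, the local cohomology modules $H^i_{\mathfrak m}(S/I)$ are $\mathbb Z^n$-graded, $[M]_{\mathbf a}$ denotes the component of degree $\mathbf a\in\mathbb Z^n$ of a $\mathbb Z^n$-graded module $M$, and $\mathbf e_u$ is the $u$-th unit vector. *)

(* Defs.v *)
From HB Require Import structures.
From mathcomp Require Import all_boot all_order all_algebra.
From mathcomp Require Import boolp.
From mathcomp Require Import mpoly.

Set Implicit Arguments.
Unset Strict Implicit.
Unset Printing Implicit Defensive.

Import GRing.Theory.
Local Open Scope ring_scope.
Local Open Scope quotient_scope.

(* Ideals of a commutative ring R are the submodules of R^o, that is, the     *)
(* library's submodClosed R^o; unlike idealr R, this includes the unit ideal. *)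

Section Span.
Variables (R : nzRingType) (V : lmodType R) (G : V -> Prop).

Definition span : {pred V} := fun v =>
  `[< exists s : seq (R * V),
        (forall p, p \in s -> G p.2) /\ v = \sum_(p <- s) p.1 *: p.2 >].

Lemma span_submod : GRing.submod_closed span.
Proof.
split; first by apply/asboolP; exists [::]; rewrite big_nil.
move=> a u v /asboolP[s [sG ->]] /asboolP[t [tG ->]]; apply/asboolP.
exists ([seq (a * p.1, p.2) | p <- s] ++ t); split.
  by move=> p; rewrite mem_cat => /orP[/mapP[q /sG Gq ->]//|/tG].
rewrite big_cat big_map scaler_sumr; congr (_ + _).
by apply: eq_bigr => p _; rewrite scalerA.
Qed.

HB.instance Definition _ := GRing.isSubmodClosed.Build R V span span_submod.
End Span.

Section Ideals.
Variable R : comNzRingType.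

Definition unit_ideal : {pred R^o} := predT.
Lemma unit_ideal_submod : GRing.submod_closed unit_ideal.
Proof. by []. Qed.
HB.instance Definition _ :=
  GRing.isSubmodClosed.Build R R^o unit_ideal unit_ideal_submod.

Definition ideal_mul (I J : {pred R^o}) : {pred R^o} :=
  span (fun f : R^o => exists a b : R, [/\ a \in I, b \in J & f = a * b]).
HB.instance Definition _ (I J : {pred R^o}) :=
  GRing.SubmodClosed.on (ideal_mul I J).

End Ideals.
Arguments unit_ideal R : clear implicits.

Definition psubset (T : Type) (A B : {pred T}) :=
  {subset A <= B} /\ ~ {subset B <= A}.

(* i < dim (R/I): the primes of R/I are the primes of R containing I. *)
Definition lt_krull_dim (R : comNzRingType) (i : nat) (I : {pred R^o}) :=
  exists d (p : 'I_d.+1 -> prime_idealr R),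
    [/\ (i < d)%N,
        forall j (f : R), f \in I -> p j f &
        forall j l : 'I_d.+1, (j < l)%N -> psubset (p j : pred R) (p l : pred R)].

Definition finite_length (R : nzRingType) (M : lmodType R) :=
  exists L : nat, forall l (N : 'I_l.+1 -> submodClosed M),
    (forall i j : 'I_l.+1, (i < j)%N -> psubset (N i) (N j)) -> (l <= L)%N.

(* V is the internal direct sum of the additive subgroups W j. *)
Definition is_direct_sum (V : zmodType) (J : finType) (W : J -> V -> Prop) :=
  (forall v, exists2 w : J -> V, (forall j, W j (w j)) & v = \sum_j w j) /\
  (forall w : J -> V, (forall j, W j (w j)) -> \sum_j w j = 0 ->
     forall j, w j = 0).

Section ModuleQuotient.
Variables (R : nzRingType) (V : lmodType R) (W : submodClosed V).

Definition mq_pred : {pred V} := W.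
Lemma mq_zmod_closed : zmod_closed mq_pred.
Proof.
rewrite /mq_pred; split=> [|u v Wu Wv]; first exact: rpred0.
by apply: rpredD => //; rewrite -scaleN1r; apply: rpredZ.
Qed.
HB.instance Definition _ := GRing.isZmodClosed.Build V mq_pred mq_zmod_closed.

Definition mquot := Quotient.quot mq_pred.
HB.instance Definition _ := EqQuotient.on mquot.
HB.instance Definition _ := Choice.on mquot.
HB.instance Definition _ := ZmodQuotient.on mquot.

Definition mproj (v : V) : mquot := \pi v.

Lemma mproj_eq (u v : V) : (mproj u == mproj v) = (u - v \in W).
Proof. by rewrite [RHS](Quotient.idealrBE mq_pred). Qed.

Lemma mproj_surj (x : mquot) : exists v, x = mproj v.
Proof. by exists (repr x); rewrite /mproj reprK. Qed.

Lemma mprojD : {morph mproj : u v / u + v}.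
Proof. exact: Quotient.pi_add. Qed.

Definition mquot_scale (a : R) (x : mquot) : mquot := mproj (a *: repr x).

Lemma mproj_scale a v : mquot_scale a (mproj v) = mproj (a *: v).
Proof.
apply/eqP; rewrite mproj_eq -scalerBr rpredZ // -mproj_eq /mproj.
by rewrite reprK.
Qed.

Fact mquot_scaleA a b x :
  mquot_scale a (mquot_scale b x) = mquot_scale (a * b) x.
Proof. by have [v ->] := mproj_surj x; rewrite !mproj_scale scalerA. Qed.
Fact mquot_scale1 : left_id 1 mquot_scale.
Proof. by move=> x; have [v ->] := mproj_surj x; rewrite mproj_scale scale1r. Qed.
Fact mquot_scaleDr : right_distributive mquot_scale +%R.
Proof.
move=> a x y; have [u ->] := mproj_surj x; have [v ->] := mproj_surj y.
by rewrite -mprojD !mproj_scale scalerDr mprojD.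
Qed.
Fact mquot_scaleDl x : {morph mquot_scale^~ x : a b / a + b}.
Proof.
by move=> a b; have [v ->] := mproj_surj x; rewrite !mproj_scale scalerDl mprojD.
Qed.
HB.instance Definition _ := GRing.Zmodule_isLmodule.Build R mquot
  mquot_scaleA mquot_scale1 mquot_scaleDr mquot_scaleDl.

Fact mproj_linear : linear mproj.
Proof. by move=> a u v; rewrite mprojD -mproj_scale. Qed.
HB.instance Definition _ := GRing.isLinear.Build R V mquot *:%R mproj mproj_linear.
End ModuleQuotient.

Section FractionModule.
Variable R : idomainType.

Definition frac_scale (a : R) (x : {fraction R}) : {fraction R} :=
  tofrac a * x.
Fact frac_scaleA a b x : frac_scale a (frac_scale b x) = frac_scale (a * b) x.
Proof. by rewrite /frac_scale tofracM mulrA. Qed.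
Fact frac_scale1 : left_id 1 frac_scale.
Proof. by move=> x; rewrite /frac_scale tofrac1 mul1r. Qed.
Fact frac_scaleDr : right_distributive frac_scale +%R.
Proof. by move=> a x y; rewrite /frac_scale mulrDr. Qed.
Fact frac_scaleDl x : {morph frac_scale^~ x : a b / a + b}.
Proof. by move=> a b; rewrite /frac_scale tofracD mulrDl. Qed.
HB.instance Definition _ := GRing.Zmodule_isLmodule.Build R {fraction R}
  frac_scaleA frac_scale1 frac_scaleDr frac_scaleDl.

Lemma frac_scaleE (a : R) (x : {fraction R}) : a *: x = tofrac a * x.
Proof. by []. Qed.

(* I_s as a submodule of Frac R, for s != 0; (unit_ideal R)_s is the ring R_s *)
(* itself, and (R/I)_s = R_s / I_s.                                           *)
Definition loc (s : R) (I : {pred R^o}) : {pred {fraction R}} := fun x =>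
  `[< exists (N : nat) (a : R), a \in I /\ tofrac s ^+ N * x = tofrac a >].

Lemma loc_submod s (I : submodClosed R^o) : GRing.submod_closed (loc s I).
Proof.
split.
  apply/asboolP; exists 0, 0; rewrite mulr0 tofrac0; split=> //.
  exact: (rpred0 I).
move=> c x y /asboolP[N [a [Ia ea]]] /asboolP[M [b [Ib eb]]]; apply/asboolP.
exists (N + M)%N, (c * s ^+ M * a + s ^+ N * b); split.
  by apply: (rpredD (S := I)); apply: (rpredZ (s := I)).
rewrite frac_scaleE tofracD !tofracM -ea -eb !tofracXn exprD mulrDr.
congr (_ + _); last by rewrite mulrA.
move: (tofrac c) (tofrac s ^+ N) (tofrac s ^+ M) => c1 sN sM.
by rewrite -!mulrA [sN * _]mulrC !mulrA [sM * c1]mulrC -!mulrA [x * sN]mulrC.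
Qed.

End FractionModule.

Section Cech.
Variables (k : fieldType) (n : nat) (I : submodClosed {mpoly k[n]}^o).
Local Notation S := {mpoly k[n]}.
Local Notation cochains := {ffun {set 'I_n} -> {fraction S}}.

Definition xset (s : {set 'I_n}) : S := \prod_(j in s) 'X_j.

(* The submodule, in degree i, of the families (f_s) with f_s in J_{x_s}; for *)
(* J the unit ideal these are the Cech cochains of S.                         *)
Definition cech (J : {pred S^o}) (i : nat) : {pred cochains} := fun f =>
  `[< forall s, f s \in loc (xset s) J /\ (#|s| != i -> f s = 0) >].

Definition cech_d (f : cochains) : cochains :=
  [ffun t : {set 'I_n} => \sum_(j in t) (-1) ^+ #|[set l in t | (l < j)%N]| * f (t :\ j)].

(* The Cech complex of S/I has C^i = cech S i / cech I i; these are the       *)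
(* preimages in cech S i of its cocycles and coboundaries.                    *)
Definition cocycle (i : nat) : {pred cochains} := fun f =>
  (f \in cech (unit_ideal S) i) && (cech_d f \in cech I i.+1).

Definition coboundary (i : nat) : {pred cochains} := fun f =>
  if i is j.+1 then
    `[< exists2 g, g \in cech (unit_ideal S) j & f - cech_d g \in cech I i >]
  else f \in cech I i.

Lemma cech_submod (J : submodClosed S^o) i : GRing.submod_closed (cech J i).
Proof.
have locJ s := loc_submod (xset s) J.
split.
  by apply/asboolP=> s; rewrite ffunE; split=> //; case: (locJ s).
move=> a f g /asboolP Jf /asboolP Jg; apply/asboolP=> s.
have [Jfs fs0] := Jf s; have [Jgs gs0] := Jg s; rewrite !ffunE; split.
  by case: (locJ s) => _; apply.
by move=> si; rewrite fs0 ?gs0 // scaler0 addr0.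
Qed.

Lemma cech_dZD a f g : cech_d (a *: f + g) = a *: cech_d f + cech_d g.
Proof.
apply/ffunP=> t; rewrite !ffunE scaler_sumr -big_split; apply: eq_bigr => j _.
by rewrite !ffunE mulrDr /= !frac_scaleE mulrCA.
Qed.

Lemma cech_d0 : cech_d 0 = 0.
Proof. by apply/ffunP=> t; rewrite !ffunE big1 // => j _; rewrite ffunE mulr0. Qed.

Lemma cocycle_submod i : GRing.submod_closed (cocycle i).
Proof.
have [S0 SZD] := cech_submod (unit_ideal S) i.
have [I0 IZD] := cech_submod I i.+1.
split; first by apply/andP; rewrite cech_d0.
move=> a f g /andP[Sf If] /andP[Sg Ig]; apply/andP.
by rewrite cech_dZD; split; [apply: SZD | apply: IZD].
Qed.
HB.instance Definition _ i :=
  GRing.isSubmodClosed.Build S cochains (cocycle i) (cocycle_submod i).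

Lemma coboundary_submod i : GRing.submod_closed (coboundary i).
Proof.
case: i => [|i]; first exact: cech_submod.
have [S0 SZD] := cech_submod (unit_ideal S) i.
have [I0 IZD] := cech_submod I i.+1.
split; first by apply/asboolP; exists 0 => //; rewrite cech_d0 subr0.
move=> a f g /asboolP[u Su Iu] /asboolP[v Sv Iv]; apply/asboolP.
exists (a *: u + v); first exact: SZD.
by rewrite cech_dZD opprD addrACA -scalerBr; apply: IZD.
Qed.

Record cocycles (i : nat) :=
  Cocycle { cval :> cochains; _ : cval \in cocycle i }.
HB.instance Definition _ i := [isSub for @cval i].
HB.instance Definition _ i := [Choice of cocycles i by <:].
HB.instance Definition _ i := [SubChoice_isSubLmodule of cocycles i by <:].

Definition coboundaries (i : nat) : {pred cocycles i} :=
  fun z => val z \in coboundary i.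
Lemma coboundaries_submod i : GRing.submod_closed (@coboundaries i).
Proof.
have [B0 BZD] := coboundary_submod i.
by split=> [|a f g]; rewrite !unfold_in ?raddf0 // linearP; apply: BZD.
Qed.
HB.instance Definition _ i :=
  GRing.isSubmodClosed.Build S (cocycles i) (@coboundaries i)
    (@coboundaries_submod i).

(* H^i_m(S/I), m = (x_1, ..., x_n), as the cohomology of the Cech complex. *)
Definition local_cohomology (i : nat) : lmodType S := mquot (@coboundaries i).

Definition laurent_monomial (a : 'rV[int]_n) : {fraction S} :=
  \prod_j tofrac 'X_j ^ a ord0 j.

(* [H^i_m(S/I)]_a, for the Z^n-grading induced by deg x_j = e_j: the classes  *)
(* of cocycles of degree a, the degree a part of S_{x_s} lying in k x^a. For  *)
(* this to be the grading of H^i, I has to be a monomial ideal.               *)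
Definition graded_component (i : nat) (a : 'rV[int]_n)
    (h : local_cohomology i) : Prop :=
  exists2 z : cocycles i,
    (forall s, exists c : k, z s = tofrac c%:MP * laurent_monomial a) &
    h = mproj (@coboundaries i) z.

Definition generalized_CM : Prop :=
  forall i, lt_krull_dim i I -> finite_length (local_cohomology i).

End Cech.
Arguments graded_component {k n} I i a h.

Section SimplicialComplex.
Variables (k : fieldType) (n : nat) (Delta : {set {set 'I_n}}).
Local Notation S := {mpoly k[n]}.

Definition simplicial_complex :=
  forall F G : {set 'I_n}, F \in Delta -> G \subset F -> G \in Delta.

Definition facet (F : {set 'I_n}) := maxset (fun G => G \in Delta) F.

Definition contractible_edge (u v : 'I_n) :=
  forall F : {set 'I_n}, F \in Delta ->
    F :|: [set u] \in Delta -> F :|: [set v] \in Delta ->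
    F :|: [set u; v] \in Delta.

Definition contractible :=
  forall u v : 'I_n, u != v -> [set u; v] \in Delta -> contractible_edge u v.

Definition facet_prime (F : {set 'I_n}) : {pred S^o} :=
  span (fun f : S^o => exists2 j, j \notin F & f = 'X_j).

(* I_Delta^(2) *)
Definition second_symbolic_power : {pred S^o} := fun f =>
  [forall (F | facet F), f \in ideal_mul (facet_prime F) (facet_prime F)].

Lemma second_symbolic_power_submod :
  GRing.submod_closed second_symbolic_power.
Proof.
split; first by apply/forall_inP=> F _; apply: rpred0.
move=> a f g /forall_inP If /forall_inP Ig; apply/forall_inP=> F hF.
by apply: rpredD; [apply: rpredZ; apply: If | apply: Ig].
Qed.
HB.instance Definition _ := GRing.isSubmodClosed.Build S S^o
  second_symbolic_power second_symbolic_power_submod.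

End SimplicialComplex.
Arguments facet_prime k {n} F.
Arguments second_symbolic_power k {n} Delta.

Definition unit_vector (n : nat) (u : 'I_n) : 'rV[int]_n := delta_mx ord0 u.

(* Main.v *)
(* The Cech complex of S/I, I = I_Delta^(2), is graded by Z^n.  Its part of   *)
(* degree a depends only on which x^a x_s^N, N large, lie in S and in I, and  *)
(* this does not change when a_j moves within the negative integers or within *)
(* the integers >= 2.  So a nonzero class in degree a, with a_j < 0 or        *)
(* a_j >= 2, would give nonzero classes in infinitely many degrees, against   *)
(* finite length.  There remain the degrees a = sum_(u in U) e_u.  For U      *)
(* nonempty the degree a part is the cochain complex of the union over u in U *)
(* of the stars of U \ u.  Unless #|U| = 1 or U is a 2-nonface, this union is *)
(* acyclic: it is a cone over w if U \ w is not a face for some w; otherwise  *)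
(* all pairs in U are edges, and contractibility makes any two of the stars   *)
(* meet in the star of U, so that Mayer-Vietoris applies.                     *)

Require Import Defs.
From mathcomp Require Import all_boot all_order all_algebra.
From mathcomp Require Import boolp mpoly zify ring.

Set Implicit Arguments.
Unset Strict Implicit.
Unset Printing Implicit Defensive.

Import Order.TTheory GRing.Theory Num.Theory.
Local Open Scope ring_scope.

(** The ideal is monomial, so everything splits by degree in Z^n: a homogeneous cochain of degree a
    is a simplicial cochain times x^a ([hcochain]), on which [cech_d] acts as [delta]
    ([cech_d_hcochain]). By [direct_sum_of_vanishing] it is enough that every homogeneous cocycle of
    an unlisted degree is a coboundary.

    Degree a of the complex depends only on whether each a_j is negative, 0, 1 or at least 2
    ([truncation_equiv_same_degrees]). If some a_j is negative or at least 2, a nonzero class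
    reappears in arbitrarily long runs of degrees with decreasing j-th coordinate. Multiplication by
    polynomials never lowers a degree, so the spans of initial segments of a run form a strict
    chain, against finite length ([nonreduced_degree_vanishing]).

    Otherwise a is the indicator of a set U, and [lm_indicator_loc] turns the complex into the
    augmented cochains of the union of the stars of U \ u, u in U. Split off the star of U \ w: it
    is a cone over any v in U \ w, the other stars form a cone over w, and contractibility of the
    edges {u, w} makes the intersection the star of U, again a cone over v. Two cone contractions
    then give an explicit primitive ([union_cones_acyclic], [squarefree_degree_vanishing]). *)

(** * Simplicial cochains *)

Section SimplicialCochains.
Variables (k : comNzRingType) (n : nat).
Local Notation cochain := ({set 'I_n} -> k).
Implicit Types (c : cochain) (s t : {set 'I_n}) (j w : 'I_n).

Definition isign j t : k := (-1) ^+ #|[set l in t | (l < j)%N]|.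

(** Coboundary of the augmented cochain complex of the full simplex, all degrees together; a
    subcomplex enters only through the faces on which an identity is required. *)
Definition delta c t : k := \sum_(j in t) isign j t * c (t :\ j).

Definition cone w c s : k := if w \in s then 0 else isign w s * c (w |: s).

Lemma isignM j t : isign j t * isign j t = 1.
Proof. by rewrite /isign -expr2 sqrr_sign. Qed.

Lemma isignD1 j l t : l \in t ->
  isign j t = (-1) ^+ (l < j)%N * isign j (t :\ l).
Proof.
move=> lt; rewrite /isign -exprD; congr (_ ^+ _).
rewrite (cardsD1 l) inE lt /=; congr (_ + _)%N.
by apply: eq_card => i; rewrite !inE andbA.
Qed.

Lemma isignD1_id j t : isign j (t :\ j) = isign j t.
Proof.
rewrite /isign; congr (_ ^+ _); apply: eq_card => l; rewrite !inE.
by case: eqP => [->|_]; rewrite ?ltnn ?andbF ?andbT.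
Qed.

(** Adding w and removing j in the two possible orders give opposite signs, so only the term that
    removes w itself survives. *)
Lemma cone_homotopy w c t : delta (cone w c) t + cone w (delta c) t = c t.
Proof.
rewrite {2}/cone; have [wt|wt] := boolP (w \in t).
  rewrite addr0 /delta (bigD1 w) //= big1 ?addr0.
    by rewrite /cone !inE eqxx /= mulrA isignD1_id isignM mul1r setD1K.
  by move=> j /andP[_ jw]; rewrite /cone !inE eq_sym jw wt mulr0.
have ww : w \in w |: t by rewrite setU11.
have ew : (w |: t) :\ w = t by rewrite setU1K.
have ewt : isign w (w |: t) = isign w t by rewrite -isignD1_id ew.
have jw j : j \in t -> j != w by move=> jt; apply: contraNneq wt => <-.
have -> : delta c (w |: t) =
    isign w t * c t + \sum_(j in t) isign j (w |: t) * c ((w |: t) :\ j).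
  rewrite /delta (bigD1 w) //= ew ewt; congr (_ + _); apply: eq_bigl => j.
  by rewrite !inE; case: eqVneq => [->|_] /=; rewrite ?(negPf wt) ?andbT.
rewrite mulrDr mulrA isignM mul1r addrCA -[RHS]addr0; congr (_ + _).
rewrite mulr_sumr -big_split big1 // => j jt /=.
have -> : (w |: t) :\ j = w |: t :\ j.
  by apply/setP=> l; rewrite !inE; case: (eqVneq l w) => [->|//];
    rewrite eq_sym jw.
rewrite /cone !inE (negPf wt) andbF /=.
rewrite (isignD1 j ww) ew (isignD1 w jt).
have -> : (-1) ^+ (w < j)%N = - (-1) ^+ (j < w)%N :> k.
  have := jw _ jt; rewrite -val_eqE /= neq_ltn => /orP[] lt.
    by rewrite lt ltnNge ltnW //= opprK.
  by rewrite lt ltnNge ltnW.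
have := sqrr_sign k (j < w)%N; move: ((-1) ^+ _) => e; move: (isign j t) => a.
move: (isign w _) => b; move: (c _) => x e2.
by transitivity (a * b * x * (1 - e ^+ 2)); [ring | rewrite e2 subrr mulr0].
Qed.

Lemma delta_cone w c t :
  (w \notin t -> delta c (w |: t) = 0) -> delta (cone w c) t = c t.
Proof.
move=> dc0; rewrite -[RHS](cone_homotopy w).
suff -> : cone w (delta c) t = 0 by rewrite addr0.
by rewrite /cone; case: ifPn => // /dc0->; rewrite mulr0.
Qed.

Lemma eq_delta c c' t : (forall s, c s = c' s) -> delta c t = delta c' t.
Proof. by move=> cc; apply: eq_bigr => j _; rewrite cc. Qed.

Lemma deltaB c c' t : delta (fun s => c s - c' s) t = delta c t - delta c' t.
Proof. by rewrite /delta -sumrB; apply: eq_bigr => j _; rewrite mulrBr. Qed.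

(* By [cone_homotopy], delta \o delta commutes with [cone w], which reduces   *)
(* its value at t to one at t :\ w.                                           *)
Lemma delta_delta c t : delta (delta c) t = 0.
Proof.
have [m tm] := ubnP #|t|; elim: m t tm c => // m IHm t tm c.
have [->|[w wt]] := set_0Vmem t; first by rewrite /delta big_set0.
have K0 : cone w (delta (delta c)) (t :\ w) = 0.
  have := cone_homotopy w (delta c) (t :\ w).
  have e s : delta (cone w c) s = c s - cone w (delta c) s.
    by rewrite -[c s in RHS](cone_homotopy w) addrK.
  have : delta (delta (cone w c)) (t :\ w) = 0.
    by apply: IHm; move: tm; rewrite (cardsD1 w) wt.
  rewrite (eq_delta _ e) deltaB => /eqP; rewrite subr_eq0 => /eqP <-.
  by move=> /eqP; rewrite addrC -subr_eq0 addrK => /eqP.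
move: K0; rewrite /cone !inE eqxx /= setD1K // => K0.
by rewrite -[LHS]mul1r -(isignM w (t :\ w)) -mulrA K0 mulr0.
Qed.

Lemma cone_support w c i s :
  (forall s', c s' != 0 -> #|s'| = i) -> cone w c s != 0 -> #|s|.+1 = i.
Proof.
move=> ci; rewrite /cone; case: ifPn => [_|ws]; rewrite ?eqxx // => cs.
rewrite -(ci (w |: s)) ?cardsU1 ?ws //.
by apply: contraNneq cs => ->; rewrite mulr0.
Qed.

Lemma delta_support c i s :
  (forall s', c s' != 0 -> #|s'|.+1 = i) -> delta c s != 0 -> #|s| = i.
Proof.
move=> ci; apply: contraNeq => si; rewrite /delta big1 // => j js.
have [->|/ci sj] := eqVneq (c (s :\ j)) 0; first by rewrite mulr0.
by case/eqP: si; rewrite -sj (cardsD1 j s) js.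
Qed.

Definition down_closed (A : {set {set 'I_n}}) :=
  forall s t, s \in A -> t \subset s -> t \in A.

Definition cone_over w (A : {set {set 'I_n}}) :=
  forall s, s \in A -> w |: s \in A.

(* The Mayer-Vietoris argument for a union of two cones meeting in a cone. *)
Lemma union_cones_acyclic (A B : {set {set 'I_n}}) v w c :
    down_closed A -> down_closed B ->
    cone_over v A -> cone_over w B -> cone_over v (A :&: B) ->
    (forall t, t \in A :|: B -> delta c t = 0) ->
  let c' s := c s - delta (cone w c) s in
  let g s := cone w c s + (if s \in A then cone v c' s else 0) in
  forall t, t \in A :|: B -> c t = delta g t.
Proof.
move=> Adown Bdown Av Bw ABv dc0 c' g t tAB.
(* Subtracting the primitive over the cone B leaves a cochain that vanishes on B, hence lives on A
   relative to the intersection. *)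
have c'B s : s \in B -> c' s = 0.
  move=> sB; rewrite /c' delta_cone ?subrr // => _; apply: dc0.
  by rewrite inE Bw // orbT.
have dc'0 s : s \in A -> delta c' s = 0.
  by move=> sA; rewrite deltaB delta_delta dc0 ?subr0 // inE sA.
suff dg1 : delta (fun s => if s \in A then cone v c' s else 0) t = c' t.
  transitivity (delta (cone w c) t + c' t); first by rewrite /c' subrKC.
  by rewrite -dg1 /delta -big_split; apply: eq_bigr => j _; rewrite mulrDr.
have [tA|tA] := boolP (t \in A).
  rewrite -(@delta_cone v c' t) => [|_]; last exact/dc'0/Av.
  by apply: eq_bigr => j jt; rewrite (Adown t) // subsetDl.
have tB : t \in B by move: tAB; rewrite inE (negPf tA).
rewrite c'B // /delta big1 // => j jt; case: ifPn => [jA|_];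
  last by rewrite mulr0.
(* For t in B outside A, a face in A lies in the intersection; there coning with v stays inside B,
   where [c'] is zero. *)
have jB : t :\ j \in B by apply: Bdown tB _; rewrite subsetDl.
rewrite /cone; case: ifP; rewrite ?mulr0 // c'B ?mulr0 //.
have /ABv : t :\ j \in A :&: B by rewrite inE jA.
by rewrite inE => /andP[].
Qed.

End SimplicialCochains.

(** * Coefficients of Laurent polynomials *)

Section LaurentCoefficients.
Variables (k : fieldType) (n : nat).
Local Notation S := {mpoly k[n]}.
Local Notation K := {fraction S}.
Local Notation lm := (@laurent_monomial k n).
Implicit Types (a : 'rV[int]_n) (b m : 'X_{1..n}) (f : K) (g : S).

Definition mvec m : 'rV[int]_n := \row_j (m j : int).

Lemma mvecD m m' : mvec (m + m')%MM = mvec m + mvec m'.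
Proof. by apply/rowP=> j; rewrite !mxE mnmDE PoszD. Qed.

Lemma mvec_inj : injective mvec.
Proof.
by move=> m m' /rowP mm; apply/mnmP=> j; have := mm j; rewrite !mxE => -[].
Qed.

Lemma mvec_shift a : exists b m, mvec m = a + mvec b.
Proof.
exists [multinom `|a ord0 j|%N | j < n].
exists [multinom `|a ord0 j + `|a ord0 j|%N : int|%N | j < n].
apply/rowP=> j; rewrite !mxE !mnmE gez0_abs // abszE -lerBlDl sub0r.
by rewrite -normrN ler_norm.
Qed.

Lemma mpolyXn_neq0 m : tofrac 'X_[m] != 0 :> K.
Proof. by rewrite tofrac_eq0 -msupp_eq0 msuppX. Qed.

Lemma lmD a (b : 'rV[int]_n) : lm (a + b) = lm a * lm b.
Proof.
rewrite /laurent_monomial -big_split; apply: eq_bigr => j _ /=.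
by rewrite mxE expfzDr // mpolyXn_neq0.
Qed.

Lemma lm_mvec m : lm (mvec m) = tofrac 'X_[m].
Proof.
rewrite mpolyXE_id rmorph_prod /laurent_monomial; apply: eq_bigr => j _.
by rewrite mxE rmorphXn.
Qed.

Lemma lm0 : lm 0 = 1.
Proof. by rewrite /laurent_monomial big1 // => j _; rewrite mxE. Qed.

Lemma lm_neq0 a : lm a != 0.
Proof.
apply: contraTneq isT => a0; have := oner_neq0 K.
by rewrite -lm0 -(subrr a) lmD a0 mul0r eqxx.
Qed.

Definition laurent f := exists b g, tofrac 'X_[b] * f = tofrac g.

Definition lcoef_spec a f (c : k) := exists b m g,
  [/\ tofrac 'X_[b] * f = tofrac g, mvec m = a + mvec b & c = g@_m].

(** Clear denominators with a monomial x^b and read off the coefficient at a + b; [lcoefE] shows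
    that b does not matter. The value is 0 off the Laurent polynomials. *)
Definition lcoef a f : k :=
  if pselect (exists c, lcoef_spec a f c) is left e then projT1 (cid e) else 0.

Lemma lcoefE a f b m g :
  tofrac 'X_[b] * f = tofrac g -> mvec m = a + mvec b -> lcoef a f = g@_m.
Proof.
move=> fg mab; rewrite /lcoef; case: pselect => [e|[]]; last first.
  by exists g@_m, b, m, g.
case: (cid e) => c /= [b' [m' [g' [fg' mab' ->]]]].
have gg : g' * 'X_[b] = g * 'X_[b'].
  apply/eqP; rewrite -tofrac_eq !tofracM -fg -fg'; apply/eqP.
  by rewrite mulrAC [RHS]mulrAC [X in X * f]mulrC.
have mm : (b + m' = b' + m)%MM.
  apply: mvec_inj; rewrite !mvecD mab mab' addrCA [RHS]addrCA.
  by rewrite [mvec b + _]addrC.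
by rewrite -(mcoeffMX g' b m') gg mm mcoeffMX.
Qed.

(** The given b need not make a + b nonnegative, hence the extra factor x^b1 in the proof; a nonzero
    coefficient then shows that a + b is an exponent after all. *)
Lemma lcoef_msupp a f b g :
    tofrac 'X_[b] * f = tofrac g -> lcoef a f != 0 ->
  exists2 m, m \in msupp g & mvec m = a + mvec b.
Proof.
move=> fg; have [b1 [m1 bm1]] := mvec_shift a.
rewrite (@lcoefE _ _ (b1 + b)%MM (m1 + b)%MM (g * 'X_[b1])).
- rewrite -mcoeff_msupp (perm_mem (msuppMX g b1)) => /mapP[m mg mm].
  exists m => //; apply: (addIr (mvec b1)).
  by rewrite addrAC -bm1 [mvec m + _]addrC -!mvecD mm.
- by rewrite mpolyXD !tofracM -fg -mulrA mulrC.
- by rewrite !mvecD bm1 addrA.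
Qed.

Lemma laurent_rep a f : laurent f -> exists b m g,
  tofrac 'X_[b] * f = tofrac g /\ mvec m = a + mvec b.
Proof.
move=> [b0 [g0 fg0]]; have [b1 [m1 ab1]] := mvec_shift a.
exists (b1 + b0)%MM, (m1 + b0)%MM, ('X_[b1] * g0).
by rewrite mpolyXD !tofracM -mulrA fg0 !mvecD ab1 addrA.
Qed.

Lemma laurent_rep2 a f f' : laurent f -> laurent f' -> exists b m g g',
  [/\ tofrac 'X_[b] * f = tofrac g, tofrac 'X_[b] * f' = tofrac g' &
      mvec m = a + mvec b].
Proof.
move=> /(laurent_rep a)[b [m [g [fg ab]]]] [b' [g' fg']].
exists (b + b')%MM, (m + b')%MM, ('X_[b'] * g), ('X_[b] * g').
split; last by rewrite !mvecD ab addrA.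
  by rewrite mpolyXD !tofracM -fg mulrCA mulrA.
by rewrite mpolyXD !tofracM -fg' mulrA.
Qed.

Lemma lcoefD a f f' :
  laurent f -> laurent f' -> lcoef a (f + f') = lcoef a f + lcoef a f'.
Proof.
move=> lf lf'; have [b [m [g [g' [fg fg' ab]]]]] := laurent_rep2 a lf lf'.
rewrite (lcoefE fg ab) (lcoefE fg' ab) -mcoeffD; apply: lcoefE ab.
by rewrite mulrDr fg fg' tofracD.
Qed.

Lemma lcoefCM a f (c : k) :
  laurent f -> lcoef a (tofrac c%:MP * f) = c * lcoef a f.
Proof.
move=> /(laurent_rep a)[b [m [g [fg ab]]]].
rewrite (lcoefE fg ab) -mcoeffCM; apply: lcoefE ab.
by rewrite mulrCA fg tofracM.
Qed.

Lemma laurent_tofrac g : laurent (tofrac g).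
Proof. by exists 0%MM, g; rewrite mpolyX0 tofrac1 mul1r. Qed.

Lemma laurentD f f' : laurent f -> laurent f' -> laurent (f + f').
Proof.
move=> lf lf'; have [b [m [g [g' [fg fg' _]]]]] := laurent_rep2 0 lf lf'.
by exists b, (g + g'); rewrite mulrDr fg fg' tofracD.
Qed.

Lemma laurentM f f' : laurent f -> laurent f' -> laurent (f * f').
Proof.
move=> [b [g fg]] [b' [g' fg']]; exists (b + b')%MM, (g * g').
by rewrite mpolyXD !tofracM -fg -fg' mulrACA.
Qed.

Lemma laurentZ g f : laurent f -> laurent (tofrac g * f).
Proof. exact/laurentM/laurent_tofrac. Qed.

Lemma laurentB f f' : laurent f -> laurent f' -> laurent (f - f').
Proof.
move=> lf lf'; apply: laurentD => //; rewrite -mulN1r -tofrac1 -tofracN.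
exact: laurentZ.
Qed.

Lemma laurent_sum (I : eqType) (r : seq I) (F : I -> K) (P : pred I) :
  (forall i, P i -> laurent (F i)) -> laurent (\sum_(i <- r | P i) F i).
Proof.
move=> lF; elim/big_ind: _ => //; last exact: laurentD.
by rewrite -tofrac0; apply: laurent_tofrac.
Qed.

Lemma laurent_lm a : laurent (lm a).
Proof.
have [b [m ab]] := mvec_shift a; exists b, 'X_[m].
by rewrite -!lm_mvec ab lmD mulrC.
Qed.

Lemma lcoef0 a : lcoef a 0 = 0.
Proof.
have l1 := laurent_tofrac 1.
by rewrite -{1}(mul0r (tofrac 1)) -tofrac0 -mpolyC0 lcoefCM // mul0r.
Qed.

Lemma lcoefB a f f' :
  laurent f -> laurent f' -> lcoef a (f - f') = lcoef a f - lcoef a f'.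
Proof.
move=> lf lf'; rewrite -{2}(subrK f' f) [in RHS]lcoefD ?addrK //.
exact: laurentB.
Qed.

Lemma lcoef_sum a (I : eqType) (r : seq I) (F : I -> K) (P : pred I) :
  (forall i, P i -> laurent (F i)) ->
  lcoef a (\sum_(i <- r | P i) F i) = \sum_(i <- r | P i) lcoef a (F i).
Proof.
move=> lF; elim: r => [|i r IHr]; first by rewrite !big_nil lcoef0.
rewrite !big_cons; case: ifP => // Pi; rewrite lcoefD ?IHr //; first exact: lF.
exact: laurent_sum.
Qed.

Lemma lcoef_shift a (b : 'rV[int]_n) f : laurent f ->
  lcoef (a + b) (lm b * f) = lcoef a f.
Proof.
move=> /(laurent_rep a)[c [m [g [fg ac]]]]; have [b1 [m1 bm]] := mvec_shift b.
rewrite (lcoefE fg ac) -(mcoeffMX g m1 m).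
apply: (@lcoefE _ _ (c + b1)%MM); last by rewrite !mvecD ac bm addrC addrACA.
rewrite mpolyXD !tofracM -fg -!lm_mvec bm lmD.
by rewrite [LHS]mulrACA [RHS]mulrACA [f * _]mulrC.
Qed.

Lemma lcoef_tofrac_neg a g (j : 'I_n) : a ord0 j < 0 -> lcoef a (tofrac g) = 0.
Proof.
move=> aj; apply/eqP/contraT.
have g0 : tofrac 'X_[0] * tofrac g = tofrac g by rewrite mpolyX0 tofrac1 mul1r.
by move=> /(lcoef_msupp g0)[m _ /rowP/(_ j)]; rewrite !mxE mnm0E addr0 => e;
  rewrite -e in aj.
Qed.

Lemma lcoef_lm a (b : 'rV[int]_n) : lcoef a (lm b) = (a == b)%:R.
Proof.
have [b1 [m1 bm1]] := mvec_shift a; have [b2 [m2 bm2]] := mvec_shift b.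
rewrite (@lcoefE a _ (b1 + b2)%MM (m1 + b2)%MM 'X_[b1 + m2]).
- rewrite mcoeffX -(inj_eq mvec_inj) !mvecD bm1 bm2; congr (_%:R).
  rewrite (_ : (a == b) = (b == a)); last exact: eq_sym.
  by rewrite addrA [mvec b1 + b]addrC -!addrA (inj_eq (addIr _)).
- by rewrite -!lm_mvec -lmD !mvecD bm2 addrAC -addrA.
- by rewrite !mvecD bm1 addrA.
Qed.

(** Stated for every duplicate-free list containing the support, so that one list can serve all
    entries of a cochain in [cochain_decomp]. *)
Lemma laurent_decomp f : laurent f -> exists A : seq 'rV[int]_n, forall A',
  uniq A' -> {subset A <= A'} ->
    f = \sum_(a <- A') tofrac (lcoef a f)%:MP * lm a.
Proof.
move=> lf; have [b [g fg]] := lf.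
pose h m := mvec m - mvec b.
have h_inj : injective h by move=> m m' /addIr/mvec_inj.
exists [seq h m | m <- msupp g] => A' uA' AA'.
have out a : a \notin [seq h m | m <- msupp g] -> lcoef a f = 0.
  move=> aA; apply/eqP/(contraNT _ aA) => /(lcoef_msupp fg)[m mg am].
  by apply/mapP; exists m; rewrite // /h am addrK.
rewrite (bigID (mem [seq h m | m <- msupp g])) /= [X in _ + X]big1 ?addr0;
  last first.
  by move=> a /out->; rewrite mpolyC0 tofrac0 mul0r.
rewrite -big_filter (perm_big [seq h m | m <- msupp g]) /=; last first.
  apply: uniq_perm; [exact: filter_uniq | |].
    by rewrite (map_inj_uniq h_inj); apply: msupp_uniq.
  by move=> a; rewrite mem_filter andb_idr // => /AA'.
rewrite big_map; apply: (mulfI (mpolyXn_neq0 b)); rewrite fg {1}(mpolyE g).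
rewrite rmorph_sum mulr_sumr; apply: eq_bigr => m _ /=.
rewrite (lcoefE fg (m := m)); last by rewrite /h subrK.
by rewrite -mul_mpolyC tofracM -!lm_mvec mulrCA -lmD /h addrC subrK.
Qed.

End LaurentCoefficients.

(** * The graded Cech complex *)

Section GradedCech.
Variables (k : fieldType) (n : nat).
Local Notation S := {mpoly k[n]}.
Local Notation K := {fraction S}.
Local Notation lm := (@laurent_monomial k n).
Local Notation cochains := {ffun {set 'I_n} -> K}.
Implicit Types (a : 'rV[int]_n) (s t : {set 'I_n}) (f : cochains).
Implicit Types (c : {set 'I_n} -> k) (J : submodClosed S^o).

Definition monomial_ideal (J : {pred S^o}) :=
  forall (g : S) m, g \in J -> m \in msupp g -> ('X_[m] : S) \in J.

Lemma unit_ideal_monomial : monomial_ideal (unit_ideal S).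
Proof. by []. Qed.

Definition mset s (N : nat) : 'X_{1..n} := [multinom ((j \in s) * N)%N | j < n].

Lemma xset_exp s N : xset k s ^+ N = 'X_[mset s N].
Proof.
rewrite mpolyXE_id /xset -prodrXl big_mkcond; apply: eq_bigr => j _.
by rewrite mnmE; case: (j \in s); rewrite ?mul1n ?mul0n ?expr0.
Qed.

Lemma locP s J (x : K) :
  reflect (exists N (g : S), g \in J /\ tofrac 'X_[mset s N] * x = tofrac g)
          (x \in loc (xset k s) J).
Proof.
apply: (iffP (asboolP _)) => -[N [g [Jg xg]]]; exists N, g; split=> //.
  by rewrite -xset_exp tofracXn.
by rewrite -tofracXn xset_exp.
Qed.

Lemma loc_laurent s J (x : K) : x \in loc (xset k s) J -> laurent x.
Proof. by case/locP=> N [g [_ xg]]; exists (mset s N), g. Qed.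

Lemma loc_lmP s J a :
  reflect (exists N m, ('X_[m] : S) \in J /\ mvec m = a + mvec (mset s N))
          (lm a \in loc (xset k s) J).
Proof.
apply: (iffP (locP _ _ _)) => -[N].
  move=> [g [Jg ag]].
  have a1 : lcoef a (lm a) != 0 by rewrite lcoef_lm eqxx oner_eq0.
  have [m mg am] := lcoef_msupp ag a1; exists N, m; split=> //.
  suff -> : 'X_[m] = g by [].
  by apply/eqP; rewrite -tofrac_eq -ag -!lm_mvec -lmD am addrC.
by move=> [m [Jm am]]; exists N, 'X_[m]; rewrite -!lm_mvec -lmD am addrC.
Qed.

(** Localizing a monomial ideal at a monomial gives a span of Laurent monomials. *)
Lemma loc_lcoef s J a (x : K) : monomial_ideal J ->
  x \in loc (xset k s) J -> lcoef a x != 0 -> lm a \in loc (xset k s) J.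
Proof.
move=> mJ /locP[N [g [Jg xg]]] /(lcoef_msupp xg)[m mg am].
by apply/loc_lmP; exists N, m; split=> //; apply: mJ mg.
Qed.

Definition hcochain a c : cochains := [ffun s => tofrac (c s)%:MP * lm a].

Definition component a f := hcochain a (fun s => lcoef a (f s)).

Definition laurent_cochain f := forall s, laurent (f s).

Lemma eq_hcochain a c c' : (forall s, c s = c' s) ->
  hcochain a c = hcochain a c'.
Proof. by move=> cc; apply/ffunP=> s; rewrite !ffunE cc. Qed.

Lemma hcochainB a c c' :
  hcochain a c - hcochain a c' = hcochain a (fun s => c s - c' s).
Proof. by apply/ffunP=> s; rewrite !ffunE -mulrBl -tofracB mpolyCB. Qed.

Lemma laurent_hcochain a c : laurent_cochain (hcochain a c).
Proof. by move=> s; rewrite ffunE; apply/laurentZ/laurent_lm. Qed.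

Lemma loc_scale s J (c : k) (x : K) :
  c != 0 -> (tofrac c%:MP * x \in loc (xset k s) J) = (x \in loc (xset k s) J).
Proof.
have [_ sc] := loc_submod (xset k s) J; have [l0 _] := loc_submod (xset k s) J.
have scl (d : k) y : y \in loc (xset k s) J ->
  tofrac d%:MP * y \in loc (xset k s) J.
  by move=> ly; have := sc d%:MP y 0 ly l0; rewrite addr0.
move=> c0; apply/idP/idP => [/(scl c^-1)|/scl//].
by rewrite mulrA -tofracM -mpolyCM mulVf // mpolyC1 tofrac1 mul1r.
Qed.

Lemma hcochain_cech J i a c :
  hcochain a c \in cech J i <->
  (forall s, c s != 0 -> #|s| = i /\ lm a \in loc (xset k s) J).
Proof.
split=> [/asboolP h s cs|h].
  have [] := h s; rewrite ffunE loc_scale // => ls ci; split=> //.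
  apply/eqP; apply: contraT => /ci /eqP; rewrite mulf_eq0 (negPf (lm_neq0 _ _)).
  by rewrite orbF tofrac_eq0 mpolyC_eq0 (negPf cs).
apply/asboolP=> s; rewrite ffunE; have [->|cs] := eqVneq (c s) 0.
  rewrite mpolyC0 tofrac0 mul0r; split=> //.
  by have [] := loc_submod (xset k s) J.
by have [<- ls] := h s cs; rewrite loc_scale // ls eqxx.
Qed.

Lemma cech_laurent J i f : f \in cech J i -> laurent_cochain f.
Proof. by move=> /asboolP Jf s; have [/loc_laurent] := Jf s. Qed.

Lemma component_cech J i a f :
  monomial_ideal J -> f \in cech J i -> component a f \in cech J i.
Proof.
move=> mJ /asboolP Jf; apply/hcochain_cech => s as0; have [Js si] := Jf s.
split; last exact: loc_lcoef as0.
by apply/eqP; apply: contraNT as0 => /si->; rewrite lcoef0.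
Qed.

(** The bridge from Cech to simplicial cochains: x^a is a common factor of all entries. *)
Lemma cech_d_hcochain a c : cech_d (hcochain a c) = hcochain a (delta c).
Proof.
apply/ffunP=> t; rewrite !ffunE raddf_sum rmorph_sum mulr_suml.
apply: eq_bigr => j _; rewrite ffunE /= mpolyCM tofracM mulrA /isign.
by rewrite !rmorphXn !rmorphN1.
Qed.

Lemma laurent_cech_d f : laurent_cochain f -> laurent_cochain (cech_d f).
Proof.
move=> lf t; rewrite ffunE; apply: laurent_sum => j _.
by rewrite -tofrac1 -tofracN -tofracXn; apply: laurentZ.
Qed.

Lemma component_cech_d a f : laurent_cochain f ->
  component a (cech_d f) = cech_d (component a f).
Proof.
move=> lf; rewrite cech_d_hcochain; apply: eq_hcochain => t.
rewrite ffunE lcoef_sum; last first.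
  by move=> j _; rewrite -tofrac1 -tofracN -tofracXn; apply: laurentZ.
apply: eq_bigr => j _; rewrite -lcoefCM //; congr (lcoef _ (_ * _)).
by rewrite /isign !rmorphXn !rmorphN1.
Qed.

Lemma componentB a f f' : laurent_cochain f -> laurent_cochain f' ->
  component a (f - f') = component a f - component a f'.
Proof.
move=> lf lf'; rewrite hcochainB; apply: eq_hcochain => s.
by rewrite !ffunE lcoefB.
Qed.

Lemma laurent_cochainB f f' :
  laurent_cochain f -> laurent_cochain f' -> laurent_cochain (f - f').
Proof. by move=> lf lf' s; rewrite !ffunE; apply: laurentB. Qed.

Lemma component_hcochain a b c :
  component a (hcochain b c) = if a == b then hcochain a c else 0.
Proof.
apply/ffunP=> s; rewrite !ffunE lcoefCM ?lcoef_lm; last exact: laurent_lm.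
case: eqP => _; first by rewrite mulr1 ffunE.
by rewrite mulr0 mpolyC0 tofrac0 mul0r ffunE.
Qed.

Lemma cochain_decomp f : laurent_cochain f -> exists A : seq 'rV[int]_n,
  f = \sum_(a <- A) component a f.
Proof.
move=> lf; have /choice[A hA] : forall s, exists A : seq 'rV[int]_n, forall A',
    uniq A' -> {subset A <= A'} ->
    f s = \sum_(a <- A') tofrac (lcoef a (f s))%:MP * lm a.
  by move=> s; apply: laurent_decomp.
exists (undup (flatten [seq A s | s : {set 'I_n}])); apply/ffunP=> s.
rewrite sum_ffunE (hA s (undup (flatten [seq A s | s : {set 'I_n}])))
  ?undup_uniq //.
  by apply: eq_bigr => a _; rewrite ffunE.
move=> a As; rewrite mem_undup; apply/flattenP; exists (A s) => //.
by apply: map_f; rewrite mem_enum.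
Qed.

(** * Homogeneous parts of cocycles and coboundaries *)

Section MonomialQuotient.
Variables (I : submodClosed S^o) (i : nat).
Hypothesis mI : monomial_ideal I.

Lemma coboundary_laurent f : f \in coboundary I i -> laurent_cochain f.
Proof.
case: i => [|j] /=; first exact: cech_laurent.
move=> /asboolP[g /cech_laurent lg /cech_laurent lfg] s.
rewrite -[f s](subrK (cech_d g s)); apply: laurentD; last exact: laurent_cech_d.
by have := lfg s; rewrite !ffunE.
Qed.

Lemma component_cocycle a f : f \in cocycle I i ->
  component a f \in cocycle I i.
Proof.
case/andP=> Sf If; apply/andP; split; first exact: component_cech Sf.
rewrite -component_cech_d; last exact: cech_laurent Sf.
exact: component_cech If.
Qed.

Lemma component_coboundary a f :
  f \in coboundary I i -> component a f \in coboundary I i.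
Proof.
move=> Bf; have := coboundary_laurent Bf.
case: i Bf => [|j] /=; first by move=> + _; apply: component_cech.
move=> /asboolP[g Sg Ifg] lf; apply/asboolP; exists (component a g).
  exact: component_cech Sg.
have lg := cech_laurent Sg.
rewrite -component_cech_d // -componentB //; last exact: laurent_cech_d.
exact: component_cech Ifg.
Qed.

Lemma coboundary_components f : laurent_cochain f ->
  (forall a, component a f \in coboundary I i) -> f \in coboundary I i.
Proof.
move=> /cochain_decomp[A fA] hA; have [B0 BZD] := coboundary_submod I i.
rewrite fA; elim/big_ind: _ => [|g g' Bg Bg'|a _] //.
by rewrite -[g]scale1r; apply: BZD.
Qed.

(** All that the Cech complex of S/I sees of a degree; equal data let a coefficient function be
    moved from one degree to the other. *)
Definition same_degrees a b := forall s,
  (lm a \in loc (xset k s) (unit_ideal S)) =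
    (lm b \in loc (xset k s) (unit_ideal S)) /\
  (lm a \in loc (xset k s) I) = (lm b \in loc (xset k s) I).

Lemma same_degrees_cocycle a b c : same_degrees a b ->
  hcochain a c \in cocycle I i -> hcochain b c \in cocycle I i.
Proof.
move=> ab /andP[Sc Ic]; apply/andP; split.
  by apply/hcochain_cech => s /(proj1 (hcochain_cech _ _ _ _) Sc);
    rewrite (ab s).1.
move: Ic; rewrite !cech_d_hcochain => Ic.
by apply/hcochain_cech => s /(proj1 (hcochain_cech _ _ _ _) Ic);
  rewrite (ab s).2.
Qed.

(** Passing to the component of degree a turns any primitive into a homogeneous one. *)
Lemma hcochain_coboundary a c :
  hcochain a c \in coboundary I i <->
  exists g : {set 'I_n} -> k,
    (forall s, g s != 0 -> #|s|.+1 = i /\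
      lm a \in loc (xset k s) (unit_ideal S)) /\
    (forall s, c s - delta g s != 0 -> #|s| = i /\ lm a \in loc (xset k s) I).
Proof.
have d0 s : delta (fun=> 0 : k) s = 0.
  by rewrite /delta big1 // => j _; rewrite mulr0.
(* In cohomological degree 0 no s satisfies [#|s|.+1 = 0], which forces the primitive to be zero. *)
case: i => [|j] /=.
  split=> [Ic|[g [g0 cg]]].
    exists (fun=> 0); split=> s; first by rewrite eqxx.
    by rewrite d0 subr0; apply: (proj1 (hcochain_cech _ _ _ _) Ic).
  apply/hcochain_cech => s cs; apply: cg.
  have -> : delta g s = 0; last by rewrite subr0.
  by rewrite /delta big1 // => l _;
    have [->|/g0[]//] := eqVneq (g (s :\ l)) 0; rewrite mulr0.
split=> [/asboolP[f Sf Icf]|[g [Sg Icg]]].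
  have lf := cech_laurent Sf; exists (fun s => lcoef a (f s)); split=> s.
    have := component_cech a unit_ideal_monomial Sf.
    by move=> /hcochain_cech h /h[->].
  have := component_cech a mI Icf.
  rewrite componentB //; [|exact: laurent_hcochain|exact: laurent_cech_d].
  rewrite component_hcochain eqxx component_cech_d // cech_d_hcochain hcochainB.
  by move=> /hcochain_cech; apply.
apply/asboolP; exists (hcochain a g).
  by apply/hcochain_cech => s /Sg[[]].
by rewrite cech_d_hcochain hcochainB; apply/hcochain_cech.
Qed.

Lemma same_degrees_coboundary a b c : same_degrees a b ->
  hcochain a c \in coboundary I i -> hcochain b c \in coboundary I i.
Proof.
move=> ab /hcochain_coboundary[g [Sg Ig]]; apply/hcochain_coboundary.
by exists g; split=> s => [/Sg|/Ig]; rewrite ((ab s).1, (ab s).2).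
Qed.

End MonomialQuotient.
End GradedCech.

(** * The second symbolic power *)

Section SecondSymbolicPower.
Variables (k : fieldType) (n : nat) (Delta : {set {set 'I_n}}).
Local Notation S := {mpoly k[n]}.
Local Notation lm := (@laurent_monomial k n).
Local Notation I2 := (second_symbolic_power k Delta).
Implicit Types (F s : {set 'I_n}) (f g : S) (m : 'X_{1..n}) (a : 'rV[int]_n).

(** The order of a monomial at the prime P_F; membership in P_F^2 means order at least 2 for every
    monomial. *)
Definition outdeg F m : nat := \sum_(j | j \notin F) m j.

Definition outdeg_ge d F f := forall m, m \in msupp f -> (d <= outdeg F m)%N.

Lemma outdegD F m m' : outdeg F (m + m')%MM = (outdeg F m + outdeg F m')%N.
Proof. by rewrite /outdeg -big_split; apply: eq_bigr => j _; rewrite mnmDE. Qed.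

Lemma outdeg_geM d d' F f g :
  outdeg_ge d F f -> outdeg_ge d' F g -> outdeg_ge (d + d') F (f * g).
Proof.
move=> df dg m /msuppM_le/allpairsP[[m1 m2] /= [/df d1 /dg d2 ->]].
by rewrite outdegD leq_add.
Qed.

Lemma span_outdeg_ge d F (G : S^o -> Prop) (f : S^o) :
  (forall g, G g -> outdeg_ge d F g) -> f \in Defs.span G -> outdeg_ge d F f.
Proof.
move=> dG /asboolP[r [rG ->]] m /msupp_sum_le/flattenP[_ /mapP[p pr ->] mp].
move: pr; rewrite filter_predT => /rG/dG Gp.
exact: (@outdeg_geM 0 d F p.1 p.2).
Qed.

Lemma second_symbolic_power_outdeg F f :
  f \in I2 -> facet Delta F -> outdeg_ge 2 F f.
Proof.
move=> /forall_inP If /If; apply: span_outdeg_ge => _ [g [h [Fg Fh ->]]].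
have PF : forall f : S, f \in facet_prime k F -> outdeg_ge 1 F f.
  move=> f'; apply: span_outdeg_ge => _ [j jF ->] m.
  rewrite msuppX inE => /eqP ->; rewrite /outdeg (bigD1 j) //= mnm1E eqxx.
  by rewrite add1n.
by apply: (@outdeg_geM 1 1); apply: PF.
Qed.

Lemma outdeg_gt0 F m :
  (0 < outdeg F m)%N -> exists2 j, j \notin F & (0 < m j)%N.
Proof.
rewrite lt0n sum_nat_eq0 => /forallPn[j]; rewrite negb_imply => /andP[jF mj].
by exists j; rewrite // lt0n.
Qed.

Lemma mpolyX_second_symbolic_power m :
  (forall F, facet Delta F -> (2 <= outdeg F m)%N) -> ('X_[m] : S) \in I2.
Proof.
move=> mF; apply/forall_inP=> F /mF m2.
(* Two variables outside F, possibly equal, are split off one after the other. *)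
have [i iF mi] := outdeg_gt0 (ltnW m2).
have Ui : (U_(i) <= m)%MM by rewrite lep1mP -lt0n.
have em : m = (m - U_(i) + U_(i))%MM by rewrite submK.
have m1 : (0 < outdeg F (m - U_(i)))%N.
  move: m2; rewrite {1}em outdegD /outdeg [X in (_ + X)%N](bigD1 i) //=.
  rewrite [X in (_ + (_ + X))%N]big1.
    by rewrite mnm1E eqxx addn0 addn1.
  by move=> j /andP[_ ji]; rewrite mnm1E eq_sym (negPf ji).
have [j jF mj] := outdeg_gt0 m1.
have Uj : (U_(j) <= m - U_(i))%MM by rewrite lep1mP -lt0n.
have X_F l : l \notin F -> ('X_l : S) \in facet_prime k F.
  move=> lF; apply/asboolP; exists [:: (1, 'X_l : S^o)].
  by rewrite big_seq1 scale1r; split=> // p /[!inE] /eqP ->; exists l.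
apply/asboolP; exists [:: ('X_[m - U_(i) - U_(j)], 'X_i * 'X_j : S^o)].
split; first by move=> p /[!inE] /eqP->; exists 'X_i, 'X_j; split=> //;
  apply: X_F.
rewrite big_seq1 /= [in LHS]em -[in LHS](submK Uj) !mpolyXD.
by rewrite -mulrA ['X_j * _]mulrC.
Qed.

Lemma second_symbolic_power_monomial : monomial_ideal I2.
Proof.
move=> f m If mf; apply: mpolyX_second_symbolic_power => F FD.
exact: second_symbolic_power_outdeg If FD m mf.
Qed.

(** Adding [N + 2] on s lifts the exponents there to at least 2, so that a facet missing a vertex of
    s imposes no condition. *)
Lemma mset_shift a s (N : nat) :
    (forall j, j \notin s -> 0 <= a ord0 j) ->
    (forall j, (`|a ord0 j| <= N)%N) ->
  exists2 m, mvec m = a + mvec (mset s (N + 2)) &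
    forall j, j \in s -> (2 <= m j)%N.
Proof.
move=> a0 aN.
exists [multinom `|a ord0 j + ((j \in s) * (N + 2))%N : int|%N | j < n].
  apply/rowP=> j; rewrite !mxE !mnmE; have := aN j.
  case: (boolP (j \in s)) => [_|/a0]; rewrite ?mul1n ?mul0n.
    by set x := a _ _; lia.
  by set x := a _ _; lia.
by move=> j js; rewrite mnmE js; have := aN j; lia.
Qed.

Lemma lm_loc_unit s a :
  lm a \in loc (xset k s) (unit_ideal S) <->
  (forall j, j \notin s -> 0 <= a ord0 j).
Proof.
split=> [/loc_lmP[N [m [_ /rowP am]]] j js|a0].
  by have := am j; rewrite !mxE mnmE (negPf js) mul0n addr0 => <-.
have aN j : (`|a ord0 j| <= \max_l `|a ord0 l|)%N by apply: leq_bigmax.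
have [m am _] := mset_shift a0 aN.
by apply/loc_lmP; exists (\max_l `|a ord0 l| + 2)%N, m.
Qed.

(** Inverting x_s removes the primes of the facets not containing s; the others test exponents
    outside F, which x_s does not change. *)
Lemma lm_loc_second_symbolic_power s a :
  lm a \in loc (xset k s) I2 <->
  (forall j, j \notin s -> 0 <= a ord0 j) /\
  (forall F, facet Delta F -> s \subset F ->
    2 <= \sum_(j | j \notin F) a ord0 j).
Proof.
split=> [/loc_lmP[N [m [Im /rowP am]]]|[a0 aF]].
  have ma j : j \notin s -> a ord0 j = m j.
    by move=> js; have := am j; rewrite !mxE mnmE (negPf js) mul0n addr0 => <-.
  split=> [j /ma -> //|F FD sF].
  rewrite (eq_bigr (fun j => (m j)%:Z)); last first.
    by move=> j jF; rewrite ma //; apply: contra jF; apply: (subsetP sF).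
  rewrite -(big_morph Posz PoszD (erefl 0)).
  apply: (second_symbolic_power_outdeg Im FD).
  by rewrite msuppX inE.
have aN j : (`|a ord0 j| <= \max_l `|a ord0 l|)%N by apply: leq_bigmax.
have [m am m2] := mset_shift a0 aN.
apply/loc_lmP; exists (\max_l `|a ord0 l| + 2)%N, m; split=> //.
apply: mpolyX_second_symbolic_power => F FD.
have [sF|/subsetPn[j js jF]] := boolP (s \subset F); last first.
  by rewrite /outdeg (bigD1 j) //=; apply: leq_trans (m2 j js) (leq_addr _ _).
have := aF F FD sF; rewrite (eq_bigr (fun j => (m j)%:Z)).
  by rewrite -(big_morph Posz PoszD (erefl 0)).
move=> j jF; have /rowP/(_ j) := am; rewrite !mxE mnmE.
by rewrite (negPf (contra (subsetP sF j) jF)) mul0n addr0.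
Qed.

End SecondSymbolicPower.

(** * Finite length *)

Section FiniteLength.
Variables (k : fieldType) (n : nat) (I : submodClosed {mpoly k[n]}^o) (i : nat).
Local Notation S := {mpoly k[n]}.
Local Notation cls := (mproj (@coboundaries k n I i)).
Hypothesis mI : monomial_ideal I.

Lemma laurent_cocycle (z : cocycles I i) : laurent_cochain (val z).
Proof. by case/andP: (valP z) => /cech_laurent. Qed.

(** Multiplication by a polynomial cannot lower the j-th exponent. *)
Lemma component_scale_hcochain (a b : 'rV[int]_n) (g : S) c j :
  a ord0 j < b ord0 j -> component a (g *: hcochain b c) = 0.
Proof.
move=> ab; apply/ffunP=> s; rewrite !ffunE frac_scaleE mulrCA.
rewrite lcoefCM; last exact/laurentZ/laurent_lm.
rewrite -(subrK b a) mulrC [tofrac g * _]mulrC lcoef_shift;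
  last exact: laurent_tofrac.
rewrite (@lcoef_tofrac_neg _ _ _ _ j) ?mulr0 ?mpolyC0 ?tofrac0 ?mul0r //.
by rewrite !mxE subr_lt0.
Qed.

(* The p-th submodule is spanned by the classes of z q, q <= p; by degree     *)
(* reasons in the j-th coordinate it does not contain later classes.          *)
Lemma descending_degrees_length l (b : 'I_l.+1 -> 'rV[int]_n) c
    (z : 'I_l.+1 -> cocycles I i) j :
    (forall p q : 'I_l.+1, (p < q)%N -> b q ord0 j < b p ord0 j) ->
    (forall p, val (z p) = hcochain (b p) c) ->
    (forall p, val (z p) \notin coboundary I i) ->
  exists N : 'I_l.+1 -> submodClosed (local_cohomology I i),
    forall p q : 'I_l.+1, (p < q)%N -> psubset (N p) (N q).
Proof.
move=> b_desc zE z_nb.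
pose G (p : 'I_l.+1) (h : local_cohomology I i) :=
  exists2 q : 'I_l.+1, (q <= p)%N & h = cls (z q).
exists (fun p => (Defs.span (G p) : submodClosed (local_cohomology I i))).
move=> p q pq; split.
  move=> h /asboolP[s [sG ->]]; apply/asboolP; exists s;
    split=> // r /sG[q' q'p ->].
  by exists q' => //; apply: leq_trans q'p (ltnW pq).
have zq : cls (z q) \in Defs.span (G q).
  apply/asboolP; exists [:: (1, cls (z q))].
  split; first by move=> r /[!inE]/eqP ->; exists q.
  by rewrite big_seq1 scale1r.
move=> sub; move: (sub _ zq) => /asboolP[s [sG zs]]; have /negP[] := z_nb q.
(* Lift the combination of earlier classes to a cocycle without component of degree [b q]; comparing
   components then makes [z q] itself a coboundary. *)
have [v vs v0] : exists2 v : cocycles I i,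
    cls v = \sum_(r <- s) r.1 *: r.2 &
    component (b q) (val v) = 0.
  elim: s sG {zs} => [|r s IHs] sG.
    exists 0; first by rewrite big_nil linear0.
    apply/ffunP=> t; rewrite raddf0 !ffunE lcoef0.
    by rewrite mpolyC0 tofrac0 mul0r.
  have [|v vs v0] := IHs.
      by move=> r' r's; apply: sG; rewrite inE r's orbT.
  have [q' q'p rE] := sG r (mem_head _ _).
  exists (r.1 *: z q' + v); first by rewrite big_cons linearP /= vs rE.
  have bq : b q ord0 j < b q' ord0 j by apply: b_desc; apply: leq_ltn_trans pq.
  have := component_scale_hcochain r.1 c bq; rewrite -zE => z0.
  apply/ffunP=> t; have /ffunP/(_ t) := z0; have /ffunP/(_ t) := v0.
  rewrite linearP !ffunE lcoefD;
    [|exact/laurentZ/laurent_cocycle|exact: laurent_cocycle].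
  by rewrite mpolyCD tofracD mulrDl => -> ->; rewrite addr0.
have : val (z q) - val v \in coboundary I i.
  by have /eqP := zs; rewrite -vs mproj_eq.
move=> /(component_coboundary mI (b q)).
rewrite componentB ?v0 ?subr0; [|exact: laurent_cocycle..].
by rewrite zE component_hcochain eqxx.
Qed.

(** The degrees [b l p] may depend on the length l because a descending run of coordinates that are
    at least 2 has to start high enough. The contradiction takes l = L + 1. *)
Lemma finite_length_vanishing (b : nat -> nat -> 'rV[int]_n) a c j :
    finite_length (local_cohomology I i) ->
    (forall l p, same_degrees I a (b l p)) ->
    (forall l p q, (p < q <= l)%N -> b l q ord0 j < b l p ord0 j) ->
  hcochain a c \in cocycle I i -> hcochain a c \in coboundary I i.
Proof.
move=> [L LP] ab b_desc az; apply/idPn => anb.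
have zP l p : hcochain (b l p) c \in cocycle I i.
  exact: same_degrees_cocycle az.
have [|||N /LP] := @descending_degrees_length L.+1 (b L.+1) c
  (fun p : 'I_L.+2 => Cocycle (zP L.+1 p)) j; last by rewrite ltnn.
- by move=> p q pq; apply: b_desc; rewrite pq -ltnS ltn_ord.
- by [].
move=> p; apply: contra anb => /=; apply: same_degrees_coboundary => // s.
by have [-> ->] := ab L.+1 p s.
Qed.

End FiniteLength.

(** * Degrees with a negative coordinate or a coordinate at least 2 *)

Section Degrees.
Variables (k : fieldType) (n : nat) (Delta : {set {set 'I_n}}).
Local Notation S := {mpoly k[n]}.
Local Notation lm := (@laurent_monomial k n).
Local Notation I2 := (second_symbolic_power k Delta).
Implicit Types (a b : 'rV[int]_n) (s : {set 'I_n}).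

Definition truncation_equiv a b := forall j,
  [\/ a ord0 j = b ord0 j, a ord0 j < 0 /\ b ord0 j < 0 |
      2 <= a ord0 j /\ 2 <= b ord0 j].

(** The membership criteria ask for signs of coordinates and for a sum of nonnegative coordinates to
    be at least 2; a single coordinate that is at least 2 settles the latter. *)
Lemma truncation_equiv_same_degrees a b :
  truncation_equiv a b -> same_degrees I2 a b.
Proof.
have ge0 a' b' : truncation_equiv a' b' ->
    forall j, 0 <= a' ord0 j -> 0 <= b' ord0 j.
  move=> ab j; case: (ab j) => [->//|[+ _]|[_ b2] _].
    by rewrite ltNge => /negPf->.
  exact: le_trans b2.
have locU s a' b' : truncation_equiv a' b' ->
    lm a' \in loc (xset k s) (unit_ideal S) ->
    lm b' \in loc (xset k s) (unit_ideal S).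
  move=> ab /lm_loc_unit a0; apply/lm_loc_unit => j /a0.
  exact: ge0.
have locI s a' b' : truncation_equiv a' b' ->
    lm a' \in loc (xset k s) I2 -> lm b' \in loc (xset k s) I2.
  move=> ab /lm_loc_second_symbolic_power[a0 aF].
  have b0 j : j \notin s -> 0 <= b' ord0 j by move=> /a0; apply: ge0.
  apply/lm_loc_second_symbolic_power; split=> // F FD sF.
  have js j : j \notin F -> j \notin s by apply/contra/(subsetP sF).
  have [/existsP[j /andP[jF b2]]|/existsPn ne] :=
    boolP [exists j, (j \notin F) && (2 <= b' ord0 j)].
    rewrite (bigD1 j) //= -[2]addr0 lerD // sumr_ge0 // => l /andP[lF _].
    exact/b0/js.
  rewrite (eq_bigr (fun j => a' ord0 j)); first exact: aF.
  move=> j jF; have := ne j; rewrite jF /= => /negPf b2.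
  case: (ab j) => [->//|[+ _]|[_]]; last by rewrite b2.
  by rewrite ltNge a0 // js.
move=> ab s; have ba : truncation_equiv b a.
  by move=> j; case: (ab j) => [->|[]|[]];
    [constructor 1 | constructor 2 | constructor 3].
by split; apply/idP/idP; do [exact: locU | exact: locI].
Qed.

Lemma nonreduced_degree_vanishing i a c j :
    finite_length (local_cohomology I2 i) ->
    (a ord0 j < 0) || (2 <= a ord0 j) ->
  hcochain a c \in cocycle I2 i -> hcochain a c \in coboundary I2 i.
Proof.
move=> fl aj; pose e (m : int) : 'rV[int]_n := m *: delta_mx ord0 j.
have ej m : e m ord0 j = m by rewrite !mxE !eqxx mulr1.
have el m l : l != j -> e m ord0 l = 0.
  by move=> lj; rewrite !mxE (negPf lj) mulr0.
apply: (@finite_length_vanishing _ _ _ _ (@second_symbolic_power_monomial _ _ _)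
  (* Descend from a_j if it is negative, and from a_j + l down to a_j otherwise; truncated
     subtraction keeps the degree in its class also for p > l. *)
  (fun l p => a + e (if a ord0 j < 0 then - p%:Z else (l - p)%N%:Z)) _ _ j fl).
  move=> l p; apply: truncation_equiv_same_degrees => h; rewrite mxE.
  have [->|hj] := eqVneq h j; last by rewrite el // addr0; constructor 1.
  rewrite ej; case: ltP aj => /= [a0 _|_ a2]; [constructor 2 | constructor 3];
    split=> //.
    by move: (a ord0 j) a0; lia.
  by move: (a ord0 j) a2; lia.
by move=> l p q pq; rewrite [ltLHS]mxE [ltRHS]mxE !ej; case: ifP => _;
  rewrite ltrD2l; lia.
Qed.

End Degrees.

(** * Squarefree degrees *)

Section SquarefreeDegrees.
Variables (k : fieldType) (n : nat) (Delta : {set {set 'I_n}}).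
Local Notation lm := (@laurent_monomial k n).
Local Notation I2 := (second_symbolic_power k Delta).
Implicit Types (s t U F : {set 'I_n}).

Definition indicator U : 'rV[int]_n := \row_j (j \in U)%:Z.

Lemma sum_unit_vector U : \sum_(u in U) unit_vector u = indicator U.
Proof.
apply/rowP=> j; rewrite summxE mxE big_mkcond (bigD1 j) //= big1 ?addr0.
  by rewrite mxE !eqxx; case: (j \in U).
by move=> l lj; rewrite mxE eqxx [j == l]eq_sym (negPf lj); case: ifP.
Qed.

Lemma indicator_inj : injective indicator.
Proof.
move=> U V /rowP UV; apply/setP=> j; have := UV j; rewrite !mxE.
by case: (j \in U); case: (j \in V).
Qed.

Hypothesis Delta_complex : simplicial_complex Delta.

Lemma indicator_outdeg U F :
  (2 <= \sum_(j | j \notin F) indicator U ord0 j) = (1 < #|U :\: F|)%N.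
Proof.
have -> : \sum_(j | j \notin F) indicator U ord0 j = #|U :\: F|%:Z.
  rewrite -sum1_card (big_morph Posz PoszD (erefl 0)) big_mkcond
    [RHS]big_mkcond.
  by apply: eq_bigr => j _; rewrite mxE inE; case: (j \in F); case: (j \in U).
by lia.
Qed.

(* In degree [indicator U] the Cech complex of S/I_Delta^(2) lives on the     *)
(* union, over u in U, of the stars of U :\ u.                                *)
Lemma lm_indicator_loc U s : U != set0 ->
  (lm (indicator U) \in loc (xset k s) I2) =
    ~~ [exists u in U, s :|: U :\ u \in Delta].
Proof.
move=> U0; apply/idP/idP =>
  [/lm_loc_second_symbolic_power[_ UF]|/exists_inPn nD].
  apply/exists_inPn => u uU; apply/negP => sD.
  have [F FD sF] := maxset_exists sD.
  have := UF F FD (subset_trans (subsetUl _ _) sF).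
  rewrite indicator_outdeg ltnNge => /negP[].
  rewrite (leq_trans (subset_leq_card _) (eq_leq (cards1 u))) //.
  apply/subsetP => j; rewrite !inE => /andP[jF jU]; apply: contraNT jF => ju.
  by apply: (subsetP sF); rewrite !inE ju jU orbT.
apply/lm_loc_second_symbolic_power; split=> [j _|F FD sF]; first by rewrite mxE.
rewrite indicator_outdeg ltnNge; apply/negP=> UF1.
suff [u uU UuF] : exists2 u, u \in U & U :\ u \subset F.
  have /negP[] := nD u uU; apply: Delta_complex (maxsetp FD) _.
  by rewrite subUset sF.
(* At most one element of U lies outside F: that one is the u sought, and any element of U will do
   if there is none. *)
have [/eqP UF0|/set0Pn[u]] := boolP (U :\: F == set0).
  have /set0Pn[u uU] := U0; exists u => //.
  apply/subsetP=> j /[!inE] /andP[_ jU].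
  by apply: contraT => jF; have := in_set0 j; rewrite -UF0 inE jF jU.
rewrite inE => /andP[uF uU]; exists u => //.
apply/subsetP=> j /[!inE] /andP[ju jU].
apply: contraT => jF; move: UF1; rewrite leqNgt => /negP[].
have : [set j; u] \subset U :\: F.
  by apply/subsetP=> l; rewrite !inE => /orP[]/eqP->; rewrite ?jF ?uF.
by move/subset_leq_card; rewrite cards2 ju.
Qed.

Hypothesis Delta_contractible : contractible Delta.

(** Contractibility of {v, w}, applied to the face s + (U \ {v, w}), makes the stars of U \ v and U
    \ w meet in the star of U. *)
Lemma contractible_star v w U s : v \in U -> w \in U -> v != w ->
    [set v; w] \in Delta -> s :|: U :\ v \in Delta -> s :|: U :\ w \in Delta ->
  s :|: U \in Delta.
Proof.
move=> vU wU vw vwD svD swD; pose F := s :|: U :\ v :\ w.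
suff -> : s :|: U = F :|: [set v; w].
  apply: Delta_contractible => //.
  - by apply: Delta_complex svD _; apply: setUS; apply: subsetDl.
  - apply: Delta_complex swD _; apply/subsetP=> j; rewrite !inE.
    case: (eqVneq j v) => [->|_]; rewrite ?vU ?vw ?orbT //.
    by case: (j \in s); case: (j \in U); case: (j == w).
  - apply: Delta_complex svD _; apply/subsetP=> j; rewrite !inE.
    by case: (eqVneq j w) => [->|_]; rewrite ?wU ?(eq_sym w) ?vw ?orbT ?orbF.
apply/setP=> j; rewrite !inE.
case: (eqVneq j v) => [->|_]; first by rewrite vU !orbT.
by case: (eqVneq j w) => [->|_]; rewrite ?wU !(orbT, orbF).
Qed.

(** The hypothesis on w covers two cases at once: if U \ w is not a face, [A] below is empty and the
    union of stars is the cone [B] over w; otherwise contractible edges through w make [A :&: B] the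
    star of U. *)
Lemma squarefree_degree_vanishing i U c v w : v \in U -> w \in U -> v != w ->
    (U :\ w \in Delta -> forall u, u \in U -> u != w -> [set u; w] \in Delta) ->
  hcochain (indicator U) c \in cocycle I2 i ->
  hcochain (indicator U) c \in coboundary I2 i.
Proof.
move=> vU wU vw wD /andP[/hcochain_cech c_supp].
rewrite cech_d_hcochain => /hcochain_cech dc_supp.
have U0 : U != set0 by apply/set0Pn; exists v.
pose A := [set s | s :|: U :\ w \in Delta].
pose B := [set s | [exists u in U, (u != w) && (s :|: U :\ u \in Delta)]].
have AB s : (s \in A :|: B) = [exists u in U, s :|: U :\ u \in Delta].
  rewrite !inE; apply/orP/exists_inP =>
    [[sw|/exists_inP[u uU /andP[_ su]]]|[u uU su]].
  - by exists w.
  - by exists u.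
  - have [uw|uw] := eqVneq u w; [by left; rewrite -uw|right].
    by apply/exists_inP; exists u; rewrite ?uw.
have Adown : down_closed A.
  by move=> s t; rewrite !inE => sD ts; apply: Delta_complex sD _; apply: setSU.
have Bdown : down_closed B.
  move=> s t; rewrite !inE => /exists_inP[u uU /andP[uw sD]] ts.
  apply/exists_inP; exists u; rewrite // uw; apply: Delta_complex sD _.
  exact: setSU.
have absorb u x s : x \in U -> x != u -> x |: s :|: U :\ u = s :|: U :\ u.
  move=> xU xu; apply/setP=> j; rewrite !inE.
  by case: eqVneq => [->|]; rewrite ?xU ?xu ?orbT.
have Av : cone_over v A by move=> s; rewrite !inE absorb.
have Bw : cone_over w B.
  move=> s; rewrite !inE => /exists_inP[u uU /andP[uw sD]].
  by apply/exists_inP; exists u; rewrite // uw absorb // eq_sym.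
have ABv : cone_over v (A :&: B).
  move=> s; rewrite inE => /andP[sA]; have := sA; rewrite inE => swD.
  rewrite inE => /exists_inP[u uU /andP[uw suD]].
  have uwD : [set u; w] \in Delta.
    by apply: wD uU uw; apply: Delta_complex swD _; apply: subsetUr.
  have sUD : s :|: U \in Delta := contractible_star uU wU uw uwD suD swD.
  rewrite inE Av // inE; apply/exists_inP; exists u => //; rewrite uw.
  apply: Delta_complex sUD _; apply/subsetP => j; rewrite !inE.
  by case: eqVneq => [->|_]; rewrite ?vU ?orbT //= => /orP[->|/andP[_ ->]];
    rewrite ?orbT.
have dc0 t : t \in A :|: B -> delta c t = 0.
  rewrite AB => tD; apply: contraTeq tD => /dc_supp[_].
  by rewrite lm_indicator_loc.
pose c' s := c s - delta (cone w c) s.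
pose g s := cone w c s + (if s \in A then cone v c' s else 0).
have cg := union_cones_acyclic Adown Bdown Av Bw ABv dc0.
have cs s : c s != 0 -> #|s| = i by move=> /c_supp[].
have g1s s : cone w c s != 0 -> #|s|.+1 = i by apply: cone_support.
have c's s : c' s != 0 -> #|s| = i.
  rewrite /c'; have [->|/cs//] := eqVneq (c s) 0.
  by rewrite sub0r oppr_eq0; apply: delta_support.
have gs s : g s != 0 -> #|s|.+1 = i.
  rewrite /g; have [->|/g1s//] := eqVneq (cone w c s) 0.
  by rewrite add0r; case: ifP => [_|_ /eqP//]; apply: cone_support.
apply/hcochain_coboundary; first exact: second_symbolic_power_monomial.
exists g; split=> s.
  (* The degree is nonnegative, so x^a lies in S and the primitive may be supported on any sets of
     the right size. *)
  by move=> /gs <-; split=> //; apply/lm_loc_unit => j _; rewrite mxE.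
move=> cgs; split.
  move: cgs; have [->|/cs//] := eqVneq (c s) 0.
  by rewrite sub0r oppr_eq0; apply: delta_support.
rewrite lm_indicator_loc // -AB; apply: contra cgs => /cg ->.
by rewrite subrr.
Qed.

(** Any w with U \ w not a face will do. If there is none, every pair {u, w} in U is a face: it is U
    itself, or it misses some x of U and lies in U \ x. *)
Lemma vanishing_indicator i U c :
    [/\ U != set0, #|U| != 1 & ~~ ((#|U| == 2) && (U \notin Delta))]%N ->
  hcochain (indicator U) c \in cocycle I2 i ->
  hcochain (indicator U) c \in coboundary I2 i.
Proof.
move=> [U0 U1 U2].
suff [w wU wD] : exists2 w, w \in U &
    (U :\ w \in Delta -> forall u, u \in U -> u != w -> [set u; w] \in Delta).
  have /set0Pn[v] : U :\ w != set0.
    by apply: contra U1 => /eqP Uw; rewrite (cardsD1 w) wU Uw cards0.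
  by rewrite !inE => /andP[vw vU];
    apply: (squarefree_degree_vanishing vU wU vw wD).
have [/existsP[w /andP[wU wD]]|/existsPn UD] :=
  boolP [exists w, (w \in U) && (U :\ w \notin Delta)].
  by exists w; rewrite // (negPf wD).
have /set0Pn[w wU] := U0; exists w => // _ u uU uw.
have [Uuw|/subsetPn[x xU xuw]] := boolP (U \subset [set u; w]).
  have UE : U = [set u; w].
    by apply/eqP; rewrite eqEsubset Uuw subUset !sub1set uU wU.
  by move: U2; rewrite UE cards2 uw /= negbK.
have := UD x; rewrite xU negbK => xD; apply: Delta_complex xD _.
move: xuw; rewrite !inE negb_or => /andP[xu xw].
by apply/subsetP=> j; rewrite !inE => /orP[]/eqP->;
  rewrite ?uU ?wU andbT eq_sym.
Qed.

End SquarefreeDegrees.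

(** * The direct sum decomposition *)

Section Assembly.
Variables (k : fieldType) (n : nat) (I : submodClosed {mpoly k[n]}^o) (i : nat).
Local Notation cls := (mproj (@coboundaries k n I i)).
Hypothesis mI : monomial_ideal I.
Variables (T : finType) (deg : T -> 'rV[int]_n).
Hypothesis deg_inj : injective deg.

Lemma component_sum a (f : T -> {ffun {set 'I_n} -> {fraction {mpoly k[n]}}}) :
    (forall t, laurent_cochain (f t)) ->
  component a (\sum_t f t) = \sum_t component a (f t).
Proof.
move=> lf; apply/ffunP=> s; rewrite !(sum_ffunE, ffunE) lcoef_sum; last first.
  by move=> t _; apply: lf.
rewrite raddf_sum rmorph_sum mulr_suml; apply: eq_bigr => t _.
by rewrite ffunE.
Qed.

(** Existence: a cocycle differs from the sum of its listed components by a cochain whose components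
    are zero in the listed degrees and coboundaries in the others. Uniqueness: the component of
    degree [deg t] of a coboundary is a coboundary and isolates the summand at t. *)
Lemma direct_sum_of_vanishing :
    (forall a c, (forall t, a != deg t) -> hcochain a c \in cocycle I i ->
       hcochain a c \in coboundary I i) ->
  is_direct_sum (fun t => graded_component I i (deg t)).
Proof.
move=> van; split=> [h|w wE w0].
  have [z ->] := mproj_surj h.
  pose zt t := Cocycle (component_cocycle mI (deg t) (valP z)).
  exists (fun t => cls (zt t)).
    by move=> t; exists (zt t) => // s; exists (lcoef (deg t) (z s));
      rewrite ffunE.
  rewrite -raddf_sum; apply/eqP; rewrite mproj_eq.
  rewrite /in_mem /= /coboundaries raddfB raddf_sum /=.
  have lz := laurent_cocycle z.
  have lzt t : laurent_cochain (component (deg t) (val z)).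
    exact: laurent_hcochain.
  have ls : laurent_cochain (\sum_t component (deg t) (val z)).
    by move=> s; rewrite sum_ffunE; apply: laurent_sum => t _; apply: lzt.
  apply: coboundary_components; first exact: laurent_cochainB.
  move=> a; rewrite componentB // component_sum //.
  have [/existsP[t /eqP at_]|/existsPn at_] := boolP [exists t, a == deg t].
    rewrite (bigD1 t) //= big1.
      rewrite addr0 component_hcochain at_ eqxx subrr.
      by case: (coboundary_submod I i).
    move=> t' tt; rewrite component_hcochain at_ (inj_eq deg_inj).
    by rewrite eq_sym (negPf tt).
  rewrite big1; last by move=> t _; rewrite component_hcochain (negPf (at_ t)).
  by rewrite subr0; apply: van; last exact: component_cocycle (valP z).
have /fin_all_exists[z zP] t : exists z : cocycles I i,
    (exists c, val z = hcochain (deg t) c) /\ w t = cls z.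
  have [z /choice[c zc] wt] := wE t; exists z; split=> //.
  by exists c; apply/ffunP=> s; rewrite zc ffunE.
move=> t; have [[c zc] ->] := zP t.
have : \sum_t val (z t) \in coboundary I i.
  have /eqP : cls (\sum_t z t) = cls 0.
    rewrite !raddf_sum linear0 -[RHS]w0; apply: eq_bigr => t' _.
    by have [_ ->] := zP t'.
  by rewrite mproj_eq subr0 /in_mem /= /coboundaries raddf_sum.
move=> /(component_coboundary mI (deg t)); rewrite component_sum; last first.
  by move=> t'; apply: laurent_cocycle.
rewrite (bigD1 t) //= big1.
  rewrite zc component_hcochain eqxx addr0 -zc => zB.
  by rewrite -[RHS](linear0 cls); apply/eqP; rewrite mproj_eq subr0.
move=> t' tt; have [[c' ->] _] := zP t'.
by rewrite component_hcochain (inj_eq deg_inj) eq_sym (negPf tt).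
Qed.

End Assembly.

Theorem theorem3p6 (k : fieldType) (n : nat) (Delta : {set {set 'I_n}})
    (Delta_complex : simplicial_complex Delta)
    (Delta_contractible : contractible Delta)
    (gCM : generalized_CM (second_symbolic_power k Delta))
    (i : nat) (i_lt_dim : lt_krull_dim i (second_symbolic_power k Delta)) :
  is_direct_sum
    (fun t : unit + 'I_n + {E : {set 'I_n} | (#|E| == 2%N) && (E \notin Delta)} =>
       graded_component (second_symbolic_power k Delta) i
         match t with
         | inl (inl _) => 0
         | inl (inr u) => unit_vector u
         | inr E => \sum_(u in val E) unit_vector u
         end).
Proof.
set T := (_ + _)%type.
pose supp (t : T) : {set 'I_n} :=
  match t with
  | inl (inl _) => set0
  | inl (inr u) => [set u]
  | inr E => val E
  end.
pose deg (t : T) : 'rV[int]_n :=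
  match t with
  | inl (inl _) => 0
  | inl (inr u) => unit_vector u
  | inr E => \sum_(u in val E) unit_vector u
  end.
have degE t : deg t = indicator (supp t).
  case: t => [[[]|u]|E] /=; last exact: sum_unit_vector.
    by apply/rowP=> j; rewrite !mxE inE.
  by rewrite -sum_unit_vector big_set1.
(* Cardinalities 0, 1 and 2 separate the three kinds of summands. *)
have supp_inj : injective supp.
  have sz E : #|supp (inr E : T)| = 2 by case: E => E /= /andP[/eqP].
  move=> [[[]|u]|E] [[[]|v]|F] // e;
    move: (congr1 (fun A : {set 'I_n} => #|A|) e);
      rewrite ?sz ?cards0 ?cards1 //.
    by move=> _; move/set1_inj: e => ->.
  by move=> _; congr inr; apply: val_inj.
have mI := @second_symbolic_power_monomial k n Delta.
apply: (direct_sum_of_vanishing (deg := deg) mI).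
  by move=> t t'; rewrite !degE => /indicator_inj/supp_inj.
move=> a c a_deg; have [/existsP[j aj]|/existsPn a01] :=
    boolP [exists j, (a ord0 j < 0) || (2 <= a ord0 j)].
  exact: (nonreduced_degree_vanishing (gCM i i_lt_dim) aj).
(* All coordinates are now 0 or 1, and an unlisted degree means that the support is none of the
   exceptional sets. *)
have aE : a = indicator [set j | a ord0 j == 1].
  apply/rowP=> j; rewrite mxE inE; have := a01 j; move: (a ord0 j) => x.
  by case: eqP => [->|]; lia.
have a_supp t : [set j | a ord0 j == 1] != supp t.
  by have := a_deg t; apply: contra => /eqP e; rewrite degE -e -aE.
rewrite aE; apply: vanishing_indicator => //; split.
- exact: (a_supp (inl (inl tt))).
- by apply/cards1P => -[u aU]; have := a_supp (inl (inr u)); rewrite aU eqxx.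
- pose is_nonedge (E : {set 'I_n}) := (#|E| == 2%N) && (E \notin Delta).
  by apply/negP => aU; have := a_supp (inr (exist is_nonedge _ aU));
    rewrite eqxx.
Qed.
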